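(* For $n\ge 1$ let $a_n$ be the number of $\beta(1,0)$-trees $T$ with $2n$ nodes such that $h(T)=T$, and let $a_{n,k}$ be the number of those with root label $k$. Let $A(x)=\sum_{n\ge1}a_nx^n$ and $A(x,y)=\sum_{n\ge1,k}a_{n,k}x^ny^k$. Then $A(x)(1-A(x))^2=x$, hence $a_n=\frac{1}{n}\binom{3n-2}{n-1}$ for all $n\ge1$. Moreover, $A(x,y)$ satisfies $$[2yA(x)-1]A(x,y)^2-[3yA(x)^2-3yA(x)+1]A(x,y)+yA(x)^3-2yA(x)^2+yA(x)=0.$$
   Context: A $\beta(1,0)$-tree is a rooted plane tree (the children of each node are linearly ordered from left to right) whose nodes are labeled with positive integers such that: leaves have label $1$; the root has label equal to the sum of its children's labels; every other node has label between $1$ and the sum of its children's labels. (The one-node tree consists of a single node with label $1$.) For a $\beta(1,0)$-tree $T$, $\mathrm{root}(T)$ is the label of the root, the rightmost path is the path from the root obtained by repeatedly passing to the rightmost child until reaching a leaf, and $\mathrm{rpath}(T)$ is its number of edges. The depth of a node is its distance from the root. The map $h$ on $\beta(1,0)$-trees is defined recursively (it is a well-defined map with $\mathrm{rpath}(h(A))=\mathrm{root}(A)$ for every $A$ with at least two nodes): (i) $h$ maps the one-node tree and the one-edge tree to themselves. (ii) If the root of $T$ has exactly one child $v$, $v$ has label $c$, and $v$ is not a leaf: let $A$ be the subtree rooted at $v$, with the label of $v$ replaced by the sum of the labels of its children. Then $h(T)$ is obtained from $h(A)$ by attaching a new leaf (label $1$) as the new rightmost child of the node at depth $c-1$ on the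 rightmost path of $h(A)$, and increasing by $1$ the labels of all nodes on the rightmost path above the new leaf (i.e. at depths $0,1,\dots,c-1$). (iii) If the root of $T$ has at least two children: let $A$ be the tree formed by the root and all its subtrees except the rightmost one, with root label equal to the sum of the labels of those children, and let $B$ be the tree formed by the root and its rightmost subtree, with root label equal to the label of the rightmost child. Then $h(T)$ is obtained by identifying the rightmost leaf of $h(B)$ with the root of $h(A)$, the identified node keeping label $1$. *)

(* Defs.v *)
From Stdlib Require List.
From HB Require Import structures.
From mathcomp Require Import all_boot all_order all_algebra.
From mathcomp Require Import finmap.
From mathcomp Require Import mathcomp_extra boolp classical_sets functions.
From mathcomp Require Import cardinality.

Set Implicit Arguments.
Unset Strict Implicit.
Unset Printing Implicit Defensive.

Import GRing.Theory.

Inductive ltree : Type := Node of nat & seq ltree.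

Lemma ltree_ind_all (P : ltree -> Prop) :
  (forall l s, (forall T, List.In T s -> P T) -> P (Node l s)) ->
  forall T, P T.
Proof.
move=> IH; fix loop 1 => -[l s]; apply: IH.
elim: s => [|x s IHs] T; first by case.
by case=> [<-|]; [exact: loop | exact: IHs].
Qed.

Fixpoint ltree_encode (T : ltree) : GenTree.tree nat :=
  let: Node l s := T in GenTree.Node l (map ltree_encode s).

Fixpoint ltree_decode (t : GenTree.tree nat) : ltree :=
  match t with
  | GenTree.Leaf _ => Node 0 [::]
  | GenTree.Node l s => Node l (map ltree_decode s)
  end.

Lemma ltree_encodeK : cancel ltree_encode ltree_decode.
Proof.
elim/ltree_ind_all => l s IH /=; congr Node.
elim: s IH => [|x s IHs] IH //=; rewrite IH ?IHs //; last by left.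
by move=> T Ts; apply: IH; right.
Qed.

HB.instance Definition _ := Countable.copy ltree (can_type ltree_encodeK).

Definition label (T : ltree) : nat := let: Node l _ := T in l.
Definition children (T : ltree) : seq ltree := let: Node _ s := T in s.

Definition leaf : ltree := Node 1 [::].

Fixpoint nodes (T : ltree) : nat :=
  let: Node _ s := T in (sumn (map nodes s)).+1.

Definition sum_labels (s : seq ltree) : nat := sumn (map label s).

(** The condition on the subtree of a non-root node. *)
Fixpoint inner_beta (T : ltree) : bool :=
  let: Node l s := T in
  if s is [::] then l == 1
  else (1 <= l <= sum_labels s) && all inner_beta s.

Definition beta10 (T : ltree) : bool :=
  let: Node l s := T in
  if s is [::] then l == 1
  else (l == sum_labels s) && all inner_beta s.

Definition map_last (f : ltree -> ltree) : seq ltree -> seq ltree :=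
  fix loop s :=
    match s with
    | [::] => [::]
    | [:: x] => [:: f x]
    | x :: s' => x :: loop s'
    end.

(** [attach d T] adds a new rightmost child, a leaf, to the node at depth [d]
    on the rightmost path of [T], and adds 1 to the labels at depths [0..d] on
    that path. Only meaningful when [d] is at most the length of the path. *)
Fixpoint attach (d : nat) (T : ltree) : ltree :=
  let: Node l s := T in
  Node l.+1 (if d is d'.+1 then map_last (attach d') s else rcons s leaf).

(** [graft A B] identifies the rightmost leaf of [B] with the root of [A],
    the identified node being labeled 1. *)
Fixpoint graft (A B : ltree) : ltree :=
  let: Node l s := B in
  if s is [::] then Node 1 (children A) else Node l (map_last (graft A) s).

Definition plant (s : seq ltree) : ltree := Node (sum_labels s) s.

(** [fuel] bounds the recursion depth; [nodes T] is always enough, see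
    [h_single] and [h_many]. *)
Fixpoint h_rec (fuel : nat) (T : ltree) : ltree :=
  if fuel is fuel'.+1 then
    match children T with
    | [::] => T
    | [:: Node _ [::]] => T
    | [:: Node c s] => attach c.-1 (h_rec fuel' (plant s))
    | v :: s => graft (h_rec fuel' (plant (belast v s)))
                      (h_rec fuel' (plant [:: last v s]))
    end
  else T.

Definition h (T : ltree) : ltree := h_rec (nodes T) T.

Lemma nodesE l s : nodes (Node l s) = (sumn (map nodes s)).+1.
Proof. by []. Qed.

Lemma nodes_gt0 T : 0 < nodes T. Proof. by case: T. Qed.

Lemma h_rec_many k l v s w :
  h_rec k.+1 (Node l (rcons (v :: s) w)) =
  graft (h_rec k (plant (v :: s))) (h_rec k (plant [:: w])).
Proof. by case: v s => c [|? ?] [|? ?] //=; rewrite belast_rcons last_rcons. Qed.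

Lemma h_rec_fuel m n T : nodes T <= m -> nodes T <= n -> h_rec m T = h_rec n T.
Proof.
elim: m n T => [|m IH] [|n] [l s]; rewrite ?nodesE // !ltnS => sm sn.
case: s sm sn => [|v s] //.
case/lastP: s => [|s w] sm sn.
- case: v sm sn => c [|u s] //; rewrite /= !addn0 => sm sn.
  by rewrite (IH n).
- have lt1 k : sumn (map nodes (v :: rcons s w)) <= k -> nodes (plant (v :: s)) <= k.
    rewrite -rcons_cons map_rcons sumn_rcons => /(leq_trans _); apply.
    by rewrite /plant nodesE -addn1 leq_add2l nodes_gt0.
  have lt2 k : sumn (map nodes (v :: rcons s w)) <= k -> nodes (plant [:: w]) <= k.
    rewrite -rcons_cons map_rcons sumn_rcons => /(leq_trans _); apply.
    rewrite /plant nodesE /= addn0 -add1n leq_add2r.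
    exact: leq_trans (nodes_gt0 v) (leq_addr _ _).
  rewrite -rcons_cons !h_rec_many.
  by rewrite (IH n (plant (v :: s))) ?(IH n (plant [:: w])) ?lt1 ?lt2.
Qed.

Lemma h_leaf l : h (Node l [::]) = Node l [::].
Proof. by []. Qed.

Lemma h_edge l c : h (Node l [:: Node c [::]]) = Node l [:: Node c [::]].
Proof. by []. Qed.

Lemma h_single l c s : s <> [::] ->
  h (Node l [:: Node c s]) = attach c.-1 (h (plant s)).
Proof.
case: s => // u s _; rewrite /h nodesE.
set k := sumn _; have -> : k = nodes (plant (u :: s)) by rewrite /k /= addn0.
by [].
Qed.

Lemma h_many l s w : s <> [::] ->
  h (Node l (rcons s w)) = graft (h (plant s)) (h (plant [:: w])).
Proof.
case: s => // v s _; rewrite /h nodesE.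
set k := sumn _.
have kE : k = nodes w + sumn (map nodes (v :: s)).
  by rewrite /k map_rcons sumn_rcons addnC.
rewrite h_rec_many; congr graft; apply: h_rec_fuel => //.
  by rewrite kE /plant nodesE -add1n leq_add2r nodes_gt0.
rewrite kE /plant nodesE /= addn0 -addn1 leq_add2l.
exact: leq_trans (nodes_gt0 v) (leq_addr _ _).
Qed.

Section Counting.
Local Open Scope classical_set_scope.

Definition fixed_trees (n : nat) : set ltree :=
  [set T | [/\ beta10 T, nodes T = (2 * n)%N & h T = T]].

Definition fixed_trees_root (n k : nat) : set ltree :=
  [set T | fixed_trees n T /\ label T = k].

(** [fset_set] sends infinite sets to the empty one; see [finite_fixed_trees]. *)
Definition a_ (n : nat) : nat := #|` fset_set (fixed_trees n)|.
Definition a_root (n k : nat) : nat := #|` fset_set (fixed_trees_root n k)|.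

Lemma inner_beta_label T : inner_beta T -> label T <= nodes T.
Proof.
elim/ltree_ind_all: T => l [|x s] IH; first by move=> /= /eqP ->.
have {}IH : forall s', (forall T, List.In T s' -> List.In T (x :: s)) ->
    all inner_beta s' -> sum_labels s' <= sumn (map nodes s').
  elim=> [|y s' IHs'] //= sub /andP[yb s'b]; apply: leq_add.
    by apply: IH => //; apply: sub; left.
  by apply: IHs' => // T Ts'; apply: sub; right.
move=> /= /andP[/andP[_ le_l] allb].
by apply: (leq_trans le_l); apply: leqW; apply: IH.
Qed.

Fixpoint labels_le (m : nat) (T : ltree) : bool :=
  let: Node l s := T in (l <= m) && all (labels_le m) s.

Lemma inner_beta_labels_le m T : inner_beta T -> nodes T <= m -> labels_le m T.
Proof.
elim/ltree_ind_all: T => l s IH Tb Tm.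
rewrite /= (leq_trans (inner_beta_label Tb) Tm) /=.
have {Tb} sb : all inner_beta s by case: s Tb {IH Tm} => //= x s /andP[].
have {Tm} sm : sumn (map nodes s) <= m by exact: ltnW Tm.
elim: s IH sb sm => [|x s IHs] //= IH /andP[xb sb] xsm.
rewrite IH //=; [|by left|exact: leq_trans (leq_addr _ _) xsm].
apply: IHs => //; last exact: leq_trans (leq_addl _ _) xsm.
by move=> T Ts; apply: IH; right.
Qed.

Lemma beta10_labels_le T : beta10 T -> labels_le (nodes T) T.
Proof.
case: T => l [|x s]; first by move=> /= /eqP ->.
rewrite [beta10 _]/= => /andP[/eqP -> allb]; apply: inner_beta_labels_le => //.
rewrite /= leqnn andbT; apply/andP; split=> //.
move: allb => /= /andP[+ _]; case: x => c t /=.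
by case: t => [/eqP ->//|u t /andP[/andP[c0 _] _]]; rewrite addn_gt0 c0.
Qed.

Lemma finite_forests m b : finite_set
  [set s : seq ltree | sumn (map nodes s) <= m /\ all (labels_le b) s].
Proof.
elim: m => [|m IH].
  apply: (@sub_finite_set _ _ [set [::]]); last exact: finite_set1.
  by case=> [|[l s] t] //= [].
pose F := [set s : seq ltree | sumn (map nodes s) <= m /\ all (labels_le b) s].
pose f (p : nat * (seq ltree * seq ltree)) := Node p.1 p.2.1 :: p.2.2.
apply: (@sub_finite_set _ _ ([set [::]] `|` f @` (`I_b.+1 `*` (F `*` F)))).
  case=> [|[l s] t]; first by left.
  rewrite /= addSn ltnS => -[le_m /andP[/andP[lb sb] tb]]; right.
  exists (l, (s, t)) => //; split=> //; split; split=> //=.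
    exact: leq_trans (leq_addr _ _) le_m.
  exact: leq_trans (leq_addl _ _) le_m.
rewrite finite_setU; split; first exact: finite_set1.
apply: finite_image; apply: finite_setX; first exact: finite_II.
exact: finite_setX.
Qed.

Lemma finite_fixed_trees n : finite_set (fixed_trees n).
Proof.
pose F := [set s : seq ltree |
  sumn (map nodes s) <= (2 * n)%N /\ all (labels_le (2 * n)) s].
apply: (@sub_finite_set _ _ (head leaf @` F)).
  move=> T [Tb Tn _]; exists [:: T] => //; split => /=; first by rewrite Tn addn0.
  by rewrite -Tn beta10_labels_le.
by apply: finite_image; exact: finite_forests.
Qed.

Lemma finite_fixed_trees_root n k : finite_set (fixed_trees_root n k).
Proof. by apply: sub_finite_set (@finite_fixed_trees n) => T []. Qed.

End Counting.

Record fps (R : Type) : Type := Fps { fcoef : nat -> R }.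

Notation "{ 'fps' R }" := (fps R) (at level 0, format "{ 'fps'  R }").

Section FpsChoice.
Variable R : choiceType.

HB.instance Definition _ := [isNew for @fcoef R].
HB.instance Definition _ := [Choice of {fps R} by <:].
End FpsChoice.

Section FpsRing.
Variable R : comNzRingType.
Local Open Scope ring_scope.
Implicit Types f g e : {fps R}.

Lemma fpsP f g : (forall n, fcoef f n = fcoef g n) -> f = g.
Proof. by case: f g => [f] [g] /= fg; congr Fps; apply/funext. Qed.

Definition fps0 : {fps R} := Fps (fun=> 0).
Definition fps_opp f : {fps R} := Fps (fun n => - fcoef f n).
Definition fps_add f g : {fps R} := Fps (fun n => fcoef f n + fcoef g n).

Definition fpsC (c : R) : {fps R} := Fps (fun n => if n == 0%N then c else 0).

Definition fps_mul f g : {fps R} :=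
  Fps (fun n => \sum_(i < n.+1) fcoef f i * fcoef g (n - i)).

Fact fps_addA : associative fps_add.
Proof. by move=> f g e; apply: fpsP => n /=; rewrite addrA. Qed.
Fact fps_addC : commutative fps_add.
Proof. by move=> f g; apply: fpsP => n /=; rewrite addrC. Qed.
Fact fps_add0 : left_id fps0 fps_add.
Proof. by move=> f; apply: fpsP => n /=; rewrite add0r. Qed.
Fact fps_addN : left_inverse fps0 fps_opp fps_add.
Proof. by move=> f; apply: fpsP => n /=; rewrite addNr. Qed.

HB.instance Definition _ :=
  GRing.isZmodule.Build {fps R} fps_addA fps_addC fps_add0 fps_addN.

Let trunc m f : {poly R} := \poly_(i < m.+1) fcoef f i.

Let coef_trunc m f i : (i <= m)%N -> (trunc m f)`_i = fcoef f i.
Proof. by move=> im; rewrite coef_poly ltnS im. Qed.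

Let fcoef_mul m f g i : (i <= m)%N ->
  fcoef (fps_mul f g) i = (trunc m f * trunc m g)`_i.
Proof.
move=> im; rewrite coefM; apply: eq_bigr => j _.
have ji : (j <= i)%N by rewrite -ltnS.
by rewrite !coef_trunc ?(leq_trans ji) ?(leq_trans (leq_subr _ _)).
Qed.

Fact fps_mulC : commutative fps_mul.
Proof. by move=> f g; apply: fpsP => n; rewrite !(@fcoef_mul n) // mulrC. Qed.

Fact fps_mulA : associative fps_mul.
Proof.
move=> f g e; apply: fpsP => n.
transitivity ((trunc n f * (trunc n g * trunc n e))`_n).
  rewrite coefM; apply: eq_bigr => i _; have i_n : (i <= n)%N by rewrite -ltnS.
  by rewrite coef_trunc // (@fcoef_mul n) // leq_subr.
rewrite mulrA coefM; apply: eq_bigr => i _; have i_n : (i <= n)%N by rewrite -ltnS.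
by rewrite [in RHS](@fcoef_mul n) // coef_trunc // leq_subr.
Qed.

Fact fps_mul1 : left_id (fpsC 1) fps_mul.
Proof.
move=> f; apply: fpsP => n /=; rewrite big_ord_recl /= mul1r subn0.
by rewrite big1 ?addr0 // => i _; rewrite mul0r.
Qed.

Fact fps_mulDl : left_distributive fps_mul fps_add.
Proof.
move=> f g e; apply: fpsP => n /=; rewrite -big_split.
by apply: eq_bigr => i _; rewrite mulrDl.
Qed.

Fact fps_1neq0 : fpsC 1 != 0.
Proof.
apply/eqP => /(congr1 (fun f => fcoef f 0)) /= /eqP.
by rewrite (negPf (oner_neq0 R)).
Qed.

HB.instance Definition _ := GRing.Zmodule_isComNzRing.Build {fps R}
  fps_mulA fps_mulC fps_mul1 fps_mulDl fps_1neq0.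

Definition fpsX : {fps R} := Fps (fun n => if n == 1%N then 1 else 0).
End FpsRing.

Arguments fpsX {R}.

(** Power series in [x] and [y] are power series in [x] whose coefficients are
    power series in [y]. *)
Notation "{ 'fps2' R }" := {fps {fps R}} (at level 0, format "{ 'fps2'  R }").

Section Bivariate.
Variable R : comNzRingType.

Definition in_x (f : {fps R}) : {fps2 R} := Fps (fun n => fpsC (fcoef f n)).

Definition fps2Y : {fps2 R} := fpsC fpsX.
End Bivariate.

Arguments fps2Y {R}.

Section GeneratingFunctions.
Local Open Scope ring_scope.

Definition Ax : {fps int} := Fps (fun n => if (1 <= n)%N then (a_ n)%:R else 0).

Definition Axy : {fps2 int} :=
  Fps (fun n => Fps (fun k => if (1 <= n)%N then (a_root n k)%:R else 0)).
End GeneratingFunctions.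

(* Main.v *)
Require Import Defs.
From HB Require Import structures.
From mathcomp Require Import all_boot all_order all_algebra.
From mathcomp Require Import finmap boolp classical_sets cardinality.
From mathcomp Require Import zify ring.

(** A nonempty forest consists of its earlier trees [l] and a last tree, with
    root label [c] and subforest [r]; on the triples [(l, c, r)] the map [h]
    becomes a structural recursion exchanging concatenation with grafting, and
    [(Bnil, d + 1, T)] with attaching a leaf to [T] at depth [d]. This makes [h]
    an involution, and identifies its fixed points with the forests
    [bcat l (bgraft (h l) T)], where [l] is arbitrary and [T] is either the
    single edge or [(Bnil, d + 2, battach d S)] with [S] a smaller fixed point
    and [d < root S].

    With [P] and [x F] the series of all forests and of the fixed points, this
    reads
      [(y - 1) P = (y - 1) + x y P (P - P(x, 1) + y - 1)] and
      [(y - 1) F = P (y (y - 1) + x y^2 (F - F(x, 1)))].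
    Comparing coefficients of [x], each equation has at most one solution with
    coefficients polynomial in [y]. They are solved explicitly in terms of
    [s = 1 + x s^3], [t = x s^2] (so that [t (1 - t)^2 = x] and
    [s = 1 / (1 - t)]) and the Narayana-like series [U = 1 + z U + t z U^2] with
    [z = t (1 - t) y]:
      [P = s (1 + (z - t) U)] and
      [F = y (1 + (z - t) U) / (1 - t - z - z^2 U)].
    Putting [y = 1] gives [U = s] and [F = s^2], hence [A(x) = t]. *)

Set Implicit Arguments.
Unset Strict Implicit.
Unset Printing Implicit Defensive.

Import GRing.Theory Num.Theory.

(** * Forests as binary trees *)

(** [Bsnoc l c r] is the forest [l] followed by the tree with root label [c] over
    the forest [r]. *)
Inductive bforest : Type := Bnil | Bsnoc of bforest & nat & bforest.

Fixpoint bforest_encode (T : bforest) : GenTree.tree nat :=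
  if T is Bsnoc l c r then GenTree.Node c [:: bforest_encode l; bforest_encode r]
  else GenTree.Node 0 [::].

Fixpoint bforest_decode (t : GenTree.tree nat) : bforest :=
  if t is GenTree.Node c [:: l; r] then
    Bsnoc (bforest_decode l) c (bforest_decode r)
  else Bnil.

Lemma bforest_encodeK : cancel bforest_encode bforest_decode.
Proof. by elim=> //= l -> c r ->. Qed.

HB.instance Definition _ := Countable.copy bforest (can_type bforest_encodeK).

Fixpoint bsize (T : bforest) : nat :=
  if T is Bsnoc l _ r then (bsize l + bsize r).+1 else 0.

Fixpoint broot (T : bforest) : nat :=
  if T is Bsnoc l c _ then broot l + c else 0.

Fixpoint brpath (T : bforest) : nat :=
  if T is Bsnoc _ _ r then (brpath r).+1 else 0.

(** The bound [maxn 1 (broot r)] merges the two label rules: it is 1 at a leaf, where [r] is empty,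
    and the sum of the children's labels elsewhere. *)
Fixpoint bvalid (T : bforest) : bool :=
  if T is Bsnoc l c r then
    [&& bvalid l, bvalid r & 1 <= c <= maxn 1 (broot r)]
  else true.

Fixpoint bcat (S T : bforest) : bforest :=
  if T is Bsnoc l c r then Bsnoc (bcat S l) c r else S.

Fixpoint bgraft (S T : bforest) : bforest :=
  if T is Bsnoc l c r then Bsnoc l c (bgraft S r) else S.

(** The root above the forest is not stored, so the increment at depth 0 is visible only as the
    growth of [broot]. *)
Fixpoint battach (d : nat) (T : bforest) : bforest :=
  match d, T with
  | d'.+1, Bsnoc l c r => Bsnoc l c.+1 (battach d' r)
  | _, _ => Bsnoc T 1 Bnil
  end.

(** One clause covers all the rules: grafting [Bnil] changes nothing, which handles a single tree,
    and attaching to [Bnil] at depth 0 gives the single edge. *)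
Fixpoint bh (T : bforest) : bforest :=
  if T is Bsnoc l c r then bgraft (bh l) (battach c.-1 (bh r)) else Bnil.

(** * Sizes, root labels and validity under the forest operations *)

Lemma bgraft0 T : bgraft Bnil T = T.
Proof. by elim: T => //= l _ c r ->. Qed.

Lemma bgraftA S T U : bgraft S (bgraft T U) = bgraft (bgraft S T) U.
Proof. by elim: U => //= l _ c r ->. Qed.

Lemma bgraft_cat S T U :
  T <> Bnil -> bgraft S (bcat U T) = bcat U (bgraft S T).
Proof. by case: T. Qed.

Lemma battach_neq0 d T : battach d T <> Bnil.
Proof. by case: d T => [|d] []. Qed.

Lemma battach_cat d S T :
  T <> Bnil \/ d = 0 -> battach d (bcat S T) = bcat S (battach d T).
Proof. by case: d T => [|d] [|l c r] //; case. Qed.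

Lemma bgraft_eq0 S T : bgraft S T = Bnil -> T = Bnil.
Proof. by case: T. Qed.

Lemma bh_eq0 T : bh T = Bnil -> T = Bnil.
Proof. by case: T => //= l c r /bgraft_eq0/battach_neq0. Qed.

Lemma bsize_cat S T : bsize (bcat S T) = bsize S + bsize T.
Proof. by elim: T => //= [|l -> c r _]; lia. Qed.

Lemma bsize_graft S T : bsize (bgraft S T) = bsize S + bsize T.
Proof. by elim: T => //= [|l _ c r ->]; lia. Qed.

Lemma bsize_attach d T : bsize (battach d T) = (bsize T).+1.
Proof. by elim: d T => [|d IH] [|l c r] //=; rewrite ?IH; lia. Qed.

Lemma bsize_h T : bsize (bh T) = bsize T.
Proof. by elim: T => //= l IHl c r IHr; rewrite bsize_graft bsize_attach; lia. Qed.

Lemma bcat_inj S : injective (bcat S).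
Proof.
elim=> [|l IHl c r _] [|l' c' r'] //=.
- by move=> /(congr1 bsize) /=; rewrite bsize_cat; lia.
- by move=> /(congr1 bsize) /=; rewrite bsize_cat; lia.
- by case=> /IHl -> -> ->.
Qed.

Lemma bgraft_inj S : injective (bgraft S).
Proof.
elim=> [|l _ c r IHr] [|l' c' r'] //=.
- by move=> /(congr1 bsize) /=; rewrite bsize_graft; lia.
- by move=> /(congr1 bsize) /=; rewrite bsize_graft; lia.
- by case=> -> -> /IHr ->.
Qed.

Lemma broot_cat S T : broot (bcat S T) = broot S + broot T.
Proof. by elim: T => //= [|l -> c r _]; lia. Qed.

Lemma broot_graft S T : T <> Bnil -> broot (bgraft S T) = broot T.
Proof. by case: T. Qed.

Lemma broot_attach d T : d <= brpath T -> broot (battach d T) = (broot T).+1.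
Proof. by case: d T => [|d] [|l c r] //=; rewrite ?addn1 ?addnS. Qed.

Lemma brpath_graft S T : brpath (bgraft S T) = brpath S + brpath T.
Proof. by elim: T => /= [|l _ c r ->]; rewrite ?addn0 ?addnS. Qed.

Lemma brpath_attach d T : d <= brpath T -> brpath (battach d T) = d.+1.
Proof. by elim: d T => [|d IH] [|l c r] //= /IH ->. Qed.

Lemma broot_gt0 T : bvalid T -> T <> Bnil -> 0 < broot T.
Proof. by case: T => //= l c r /and3P[_ _ /andP[c0 _]] _; lia. Qed.

Lemma bvalid_leaf_label l c : bvalid (Bsnoc l c Bnil) -> c = 1.
Proof. by move=> /= /andP[_]; lia. Qed.

Lemma bvalid_cat S T : bvalid (bcat S T) = bvalid S && bvalid T.
Proof. by elim: T => //= [|l -> c r _]; rewrite ?andbT ?andbA. Qed.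

(** Only the label above the grafting point sees its bound change; it is 1, which every bound
    admits. *)
Lemma bvalid_graft S T : bvalid S -> bvalid T -> bvalid (bgraft S T).
Proof.
move=> vS; elim: T => //= l _ c r IHr /and3P[vl vr /andP[c0 cle]].
rewrite vl IHr //= c0 /=; case: r {IHr vr} cle => [/=|l' c' r']; last by [].
lia.
Qed.

(** Label and bound both grow by 1 along the path. Attaching below the final leaf would give it
    label 2 over one child of label 1, hence the strict inequality; [maxn 1] admits depth 0 on the
    empty forest. *)
Lemma bvalid_attach d T :
  d < maxn 1 (brpath T) -> bvalid T -> bvalid (battach d T).
Proof.
elim: d T => [|d IH] [|l c r] //=; first by move=> _ ->.
rewrite maxnSS max0n ltnS => lt_d /and3P[-> vr cP].
have r_gt0 : 0 < broot r by apply: broot_gt0 => // r0; rewrite r0 in lt_d.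
by rewrite IH ?broot_attach //=; lia.
Qed.

(** * The involution on forests *)

(** Attaching at depth [c - 1] makes the rightmost path have length [c], and grafting [bh l] adds
    [broot l]. *)
Lemma brpath_h T : bvalid T -> brpath (bh T) = broot T.
Proof.
elim: T => //= l IHl c r IHr /and3P[vl vr /andP[c0 cle]].
rewrite brpath_graft IHl // brpath_attach ?IHr //; lia.
Qed.

Lemma attach_depth_lt c r : bvalid r -> 1 <= c <= maxn 1 (broot r) ->
  c.-1 < maxn 1 (brpath (bh r)).
Proof. by move=> vr; rewrite brpath_h //; lia. Qed.

Lemma bvalid_h T : bvalid T -> bvalid (bh T).
Proof.
elim: T => //= l IHl c r IHr /and3P[vl vr cP].
by apply: bvalid_graft; rewrite ?IHl ?bvalid_attach ?attach_depth_lt ?IHr.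
Qed.

Lemma bh_cat S T : bh (bcat S T) = bgraft (bh S) (bh T).
Proof. by elim: T => //= l -> c r _; rewrite bgraftA. Qed.

Lemma bh_graft S T : bvalid T -> bh (bgraft S T) = bcat (bh S) (bh T).
Proof.
elim: T => //= l _ c r IHr /and3P[_ vr cP].
rewrite IHr // battach_cat ?bgraft_cat //; first exact: battach_neq0.
(* An empty [r] forces [c = 1], so the attachment is at depth 0; otherwise [bh r] is nonempty. *)
by case: r cP {IHr vr} => [|? ? ?] cP;
  [right; move: cP => /=; lia | left=> /bh_eq0].
Qed.

(** Under [bh], attaching a leaf at depth [d] turns into adding a new edge with label [d + 1] on
    top. With [bh_graft] this undoes each clause of [bh]. *)
Lemma bh_attach d T : bvalid T -> d < maxn 1 (brpath T) ->
  bh (battach d T) = Bsnoc Bnil d.+1 (bh T).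
Proof.
elim: d T => [|d IH] [|l c r] //=.
rewrite maxnSS max0n ltnS => /and3P[vl vr /andP[c0 _]] lt_d.
rewrite IH //; last by lia.
by case: c c0 => //= c _.
Qed.

Lemma bh_involutive T : bvalid T -> bh (bh T) = T.
Proof.
elim: T => //= l IHl c r IHr /and3P[vl vr cP].
have clt := attach_depth_lt vr cP.
rewrite bh_graft ?bvalid_attach ?bvalid_h // bh_attach ?bvalid_h //.
by rewrite IHl // IHr //=; congr Bsnoc; lia.
Qed.

(** * Structure of the fixed points *)

Lemma bcat_graft_fixed l T : bvalid l -> bvalid T -> T <> Bnil ->
  bh T = T -> bh (bcat l (bgraft (bh l) T)) = bcat l (bgraft (bh l) T).
Proof.
by move=> vl vT T0 fT; rewrite bh_cat bh_graft // bh_involutive // fT bgraft_cat.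
Qed.

(** [bh] sends [battach d T] to [T] under an edge labeled [d + 1]; attaching at depth [d + 1] then
    passes through that edge, raises its label to [d + 2] and restores [battach d T] below it. *)
Lemma indecomposable_fixed d T : bvalid T -> d < broot T -> bh T = T ->
  bh (Bsnoc Bnil d.+2 (battach d T)) = Bsnoc Bnil d.+2 (battach d T).
Proof.
move=> vT ltd fT; rewrite /= bgraft0 bh_attach ?fT //.
by rewrite -fT brpath_h //; lia.
Qed.

Lemma fixed_decomposition l c r : bvalid (Bsnoc l c r) ->
  bh (Bsnoc l c r) = Bsnoc l c r ->
  exists2 r', r = bgraft (bh l) r' &
    bvalid (Bsnoc Bnil c r') /\ bh (Bsnoc Bnil c r') = Bsnoc Bnil c r'.
Proof.
move=> v; have /= /and3P[vl vr cP] := v => /=.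
(* Grafting acts only on the last subforest, so the fixed-point equation forces
   [battach c.-1 (bh r) = Bsnoc l c r1] and [r = bgraft (bh l) r1]; [r1] is the witness. *)
case Ex: (battach _ _) => [|l1 c1 r1] /=; first by move/battach_neq0: Ex.
case=> El Ec Er; rewrite {l1}El {c1}Ec in Ex; exists r1 => //.
have vx : bvalid (Bsnoc l c r1).
  by rewrite -Ex; apply: bvalid_attach; rewrite ?bvalid_h ?attach_depth_lt.
have /= /and3P[_ v1 cP1] := vx; split; first by rewrite /= v1.
(* Since [bh r = bcat l (bh r1)], prefixing [l] turns the remaining equation into [Ex]. *)
rewrite /= bgraft0; apply: (@bcat_inj l) => /=.
move: Ex; rewrite -Er bh_graft // bh_involutive // battach_cat //.
case: r1 {Er v1} vx cP1 => [|? ? ?] vx cP1; [right|left=> /bh_eq0 //].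
by move: cP1 => /=; lia.
Qed.

Lemma indecomposable_fixed_inv c r : bvalid (Bsnoc Bnil c r) ->
  bh (Bsnoc Bnil c r) = Bsnoc Bnil c r ->
  Bsnoc Bnil c r = Bsnoc Bnil 1 Bnil \/
  exists d T, [/\ bvalid T, bh T = T, d < broot T, c = d.+2 & r = battach d T].
Proof.
move=> /= /andP[vr /andP[c0 cle]]; rewrite bgraft0.
case: c c0 cle => [|[|d]] //= _ cle; first by case=> _ <-; left.
have := brpath_h vr; have := bvalid_h vr.
case Er: (bh r) => [|l' c' r'] //= /and3P[_ vr' cP'] Erp [El Ec Ea]; right.
(* Comparing both sides gives [bh r = Bsnoc Bnil d.+1 r'] and [r = battach d r']; applying [bh] to
   the latter shows that [r'] is fixed. *)
have Ert : d < brpath r' by lia.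
exists d, r'; have fr' : bh r' = r'.
  have := Er; rewrite -Ea bh_attach //; last by lia.
  by case.
by split=> //; rewrite -brpath_h // fr'.
Qed.

(** * Correspondence with labeled trees *)

Fixpoint forest_of (T : bforest) : seq ltree :=
  if T is Bsnoc l c r then rcons (forest_of l) (Node c (forest_of r)) else [::].

Lemma forest_of_eq0 T : forest_of T = [::] -> T = Bnil.
Proof. by case: T => //= l c r; case: (forest_of l). Qed.

Lemma forest_of_inj : injective forest_of.
Proof.
elim=> [|l IHl c r IHr] [|l' c' r'] //=.
- by case: (forest_of l').
- by case: (forest_of l).
- by move=> /rcons_inj[/IHl-> -> /IHr->].
Qed.

(** Viewing a list as the children of a tree makes the induction on trees available, with an inner
    induction from the right end of the list. *)
Lemma forest_of_surj s : exists T, forest_of T = s.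
Proof.
pose P (T : ltree) := exists r, forest_of r = children T.
have PT T : P T.
  elim/ltree_ind_all: T => l {}s; rewrite /P /=.
  elim/last_ind: s => [|s [c u] IHs] IH; first by exists Bnil.
  have in_rcons T : List.In T (rcons s (Node c u)) <-> List.In T s \/ T = Node c u.
    elim: s {IHs IH} => [|x s IHs] /=; first by split=> -[]; auto.
    by rewrite IHs; tauto.
  have [|l' El] := IHs; first by move=> T Ts; apply: IH; apply/in_rcons; left.
  have [|r' /= Er] := IH (Node c u); first by apply/in_rcons; right.
  by exists (Bsnoc l' c r'); rewrite /= El Er.
by have [T] := PT (Node 0 s); exists T.
Qed.

Lemma nodes_forest_of T : sumn (map nodes (forest_of T)) = bsize T.
Proof.
elim: T => //= l IHl c r IHr; rewrite map_rcons sumn_rcons IHl /= IHr; lia.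
Qed.

Lemma sum_labels_forest_of T : sum_labels (forest_of T) = broot T.
Proof.
by elim: T => //= l IHl c r _; rewrite /sum_labels map_rcons sumn_rcons -IHl.
Qed.

Lemma inner_beta_forest_of T : all inner_beta (forest_of T) = bvalid T.
Proof.
elim: T => //= l IHl c r IHr; rewrite all_rcons IHl andbC; congr (_ && _).
case Er: (forest_of r) => [|x s].
  by rewrite (forest_of_eq0 Er) /=; lia.
rewrite -[LHS]/((1 <= c <= sum_labels (x :: s)) && all inner_beta (x :: s)).
rewrite -Er sum_labels_forest_of IHr andbC.
case vr: (bvalid r) => //=.
have rN0 : r <> Bnil by move=> r0; rewrite r0 in Er.
by have := broot_gt0 vr rN0; lia.
Qed.

Lemma map_last_rcons f s x : map_last f (rcons s x) = rcons s (f x).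
Proof. by elim: s => [|y [|z s] IH] //; rewrite [RHS]rcons_cons -IH. Qed.

Lemma attach_forest_of d l T : d <= brpath T ->
  attach d (Node l (forest_of T)) = Node l.+1 (forest_of (battach d T)).
Proof.
by elim: d l T => [|d IH] l [|l' c r] //= le_d; rewrite map_last_rcons IH.
Qed.

(** [graft] writes label 1 at the identified node while [bgraft] keeps its label; validity makes
    them agree. *)
Lemma graft_forest_of l a S T : bvalid T -> T <> Bnil ->
  graft (Node a (forest_of S)) (Node l (forest_of T)) =
  Node l (forest_of (bgraft S T)).
Proof.
elim: T l => // l' _ c r IHr l v _ /=.
case Ef: (rcons _ _) => [|x s]; first by case: (forest_of l') Ef.
rewrite -Ef map_last_rcons; congr (Node _ (rcons _ _)).
case: r IHr v {Ef} => [|l1 c1 r1] IHr v; last first.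
  by apply: IHr => //; case/and3P: v.
by rewrite /= (bvalid_leaf_label v).
Qed.

Lemma h_forest_of T : bvalid T ->
  h (plant (forest_of T)) = plant (forest_of (bh T)).
Proof.
have single c r : bvalid (Bsnoc Bnil c r) ->
    h (plant (forest_of r)) = plant (forest_of (bh r)) ->
    h (plant (forest_of (Bsnoc Bnil c r))) =
    plant (forest_of (bh (Bsnoc Bnil c r))).
  move=> v IH; have /= /andP[vr cP] := v; have cle := attach_depth_lt vr cP.
  rewrite /= bgraft0; case: (pselect (r = Bnil)) => [r0|/eqP rN0].
    by rewrite r0 in v *; rewrite (bvalid_leaf_label v).
  rewrite /plant h_single; last by move/forest_of_eq0/eqP; rewrite (negPf rN0).
  have rp0 : 0 < brpath (bh r) by rewrite brpath_h // broot_gt0 //; apply/eqP.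
  rewrite -/(plant _) IH attach_forest_of; last by lia.
  by rewrite /plant !sum_labels_forest_of broot_attach //; lia.
elim: T => // l IHl c r IHr v; have /= /and3P[vl vr cP] := v.
have v1 : bvalid (Bsnoc Bnil c r) by rewrite /= vr.
case: (pselect (l = Bnil)) => [->|lN0]; first exact: single v1 (IHr vr).
rewrite /plant h_many; last by move/forest_of_eq0.
rewrite IHl // (single c r v1 (IHr vr)) /plant.
have E0 : bh (Bsnoc Bnil c r) <> Bnil by move/bh_eq0.
have -> : battach c.-1 (bh r) = bh (Bsnoc Bnil c r).
  by rewrite /= bgraft0.
by rewrite graft_forest_of ?bvalid_h // !sum_labels_forest_of broot_graft.
Qed.

Lemma plant_forest_of_inj : injective (fun T => plant (forest_of T)).
Proof. by move=> S T [_ /forest_of_inj]. Qed.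

(** One of the [2 (n + 1)] nodes is the root. The forest left has odd size, hence is nonempty, which
    excludes the one-node tree, whose label 1 is not an empty sum. *)
Lemma fixed_trees_forest_of n X : fixed_trees n.+1 X <->
  exists T, [/\ bvalid T, bsize T = n.*2.+1, bh T = T & X = plant (forest_of T)].
Proof.
split=> [[bX nX hX]|[T [vT sT fT ->]]].
  case: X bX nX hX => l s; have [T <-] := forest_of_surj s; move=> bX.
  rewrite nodesE nodes_forest_of => nX.
  have [El vT] : l = broot T /\ bvalid T.
    case Ef: (forest_of T) bX => [|x u] /=.
      by rewrite (forest_of_eq0 Ef) /= in nX *; lia.
    rewrite -[X in _ && X]/(all inner_beta (x :: u)) -Ef.
    by rewrite sum_labels_forest_of inner_beta_forest_of => /andP[/eqP].
  rewrite El -sum_labels_forest_of -/(plant _) h_forest_of //.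
  by move/plant_forest_of_inj => fT; exists T; split=> //; lia.
split.
- rewrite /plant /beta10; case Ef: (forest_of T) => [|x u].
    by rewrite (forest_of_eq0 Ef) in sT.
  by rewrite -Ef eqxx inner_beta_forest_of.
- by rewrite nodesE nodes_forest_of sT; lia.
- by rewrite h_forest_of // fT.
Qed.

(** * Enumeration of fixed points *)

Lemma uniq_dep_pairs (S T R : eqType) (f : S -> T -> R) (s : seq S)
    (t : S -> seq T) :
  uniq s -> (forall x, x \in s -> uniq (t x)) ->
  (forall x y x' y', x \in s -> y \in t x -> x' \in s -> y' \in t x' ->
     f x y = f x' y' -> x = x' /\ y = y') ->
  uniq [seq f x y | x <- s, y <- t x].
Proof.
elim: s => //= x s IH /andP[xs us] ut fI; rewrite cat_uniq; apply/and3P; split.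
- rewrite map_inj_in_uniq ?ut ?mem_head // => y y' yx y'x.
  by move/(fI x y x y' (mem_head _ _) yx (mem_head _ _) y'x) => [].
- apply/hasPn => _ /allpairsPdep[x' [y' [x's y'x' ->]]]; apply/mapP => -[y yx].
  move/(fI x' y' x y (mem_behead (s := x :: s) x's) y'x' (mem_head _ _) yx) => [E _].
  by rewrite -E x's in xs.
- apply: IH => // [z zs|z y z' y' zs yz z's y'z']; first exact/ut/mem_behead.
  by apply: fI => //; exact: mem_behead.
Qed.

(** These are the valid forests of binary height less than [k]. Height never exceeds size, so
    [k = n + 1] reaches every valid forest of size [n]. *)
Fixpoint bforests_upto (k : nat) : seq bforest :=
  if k is k'.+1 then
    Bnil :: [seq Bsnoc p.1 c p.2
              | p <- [seq (l, r) | l <- bforests_upto k', r <- bforests_upto k'],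
                c <- iota 1 (maxn 1 (broot p.2))]
  else [::].

Definition valid_bforests (n : nat) : seq bforest :=
  [seq T <- bforests_upto n.+1 | bsize T == n].

Arguments valid_bforests : simpl never.

Lemma bforests_upto_uniq k : uniq (bforests_upto k).
Proof.
elim: k => //= k IH; apply/andP; split.
  by apply/allpairsPdep => -[p [c []]].
apply: uniq_dep_pairs.
- by apply: allpairs_uniq => // -[? ?] [? ?].
- by move=> p _; exact: iota_uniq.
- by move=> [l r] c [l' r'] c' _ _ _ _ /= [-> -> ->].
Qed.

Lemma bforests_upto_valid k T : T \in bforests_upto k -> bvalid T.
Proof.
elim: k T => //= k IH T; rewrite inE => /orP[/eqP->//|].
case/allpairsPdep=> -[l r] [c [/allpairsP[[l' r'] /= [lk rk [-> ->]]]]].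
by rewrite mem_iota => cP ->; rewrite /= !IH //=; lia.
Qed.

Lemma mem_bforests_upto k T : bvalid T -> bsize T < k -> T \in bforests_upto k.
Proof.
elim: k T => [|k IH] [|l c r] //= /and3P[vl vr cP] szT; rewrite inE; apply/orP; right.
apply/allpairsPdep; exists (l, r), c; split=> //=; last by rewrite mem_iota; lia.
by apply/allpairsP; exists (l, r); rewrite !IH //=; lia.
Qed.

Lemma mem_valid_bforests n T :
  (T \in valid_bforests n) = bvalid T && (bsize T == n).
Proof.
rewrite mem_filter andbC; case: eqP => [<-|]; rewrite ?andbF // !andbT.
apply/idP/idP; first exact: bforests_upto_valid.
by move=> vT; apply: mem_bforests_upto.
Qed.

Lemma valid_bforests_uniq n : uniq (valid_bforests n).
Proof. exact/filter_uniq/bforests_upto_uniq. Qed.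

Lemma valid_bforests0 : valid_bforests 0 = [:: Bnil].
Proof. by []. Qed.

Lemma valid_bforestsS n :
  perm_eq (valid_bforests n.+1)
    [seq Bsnoc p.1 c p.2
      | p <- [seq p | i <- iota 0 n.+1,
                p <- [seq (l, r) | l <- valid_bforests i,
                                   r <- valid_bforests (n - i)]],
        c <- iota 1 (maxn 1 (broot p.2))].
Proof.
apply: uniq_perm; first exact: valid_bforests_uniq.
  apply: uniq_dep_pairs => [|p _|]; last first.
  - by move=> [l r] c [l' r'] c' _ _ _ _ /= [-> -> ->].
  - exact: iota_uniq.
  apply: uniq_dep_pairs => [|i _|]; first exact: iota_uniq.
    by apply: allpairs_uniq => [||[? ?] [? ?]//]; exact: valid_bforests_uniq.
  move=> i p j q _ /allpairsP[[l r] /= [lP _ ->]].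
  move=> _ /allpairsP[[l' r'] /= [l'P _ ->]].
  move: lP l'P; rewrite !mem_valid_bforests => /andP[_ /eqP<-] /andP[_ /eqP<-].
  by case=> -> ->.
move=> T; rewrite mem_valid_bforests; apply/idP/allpairsPdep.
  case: T => // l c r /andP[vT /eqP[szT]].
  have /and3P[vl vr cP] : [&& bvalid l, bvalid r & 1 <= c <= maxn 1 (broot r)].
    by [].
  exists (l, r), c; split=> //; last by rewrite mem_iota /=; lia.
  apply/allpairsPdep; exists (bsize l), (l, r); split=> //.
    by rewrite mem_iota; lia.
  apply/allpairsP; exists (l, r); split=> //=; rewrite mem_valid_bforests.
    by rewrite vl eqxx.
  by rewrite vr; apply/eqP; lia.
move=> [_ [c [/allpairsPdep[i [_ [iP /allpairsP[[l r] /= [lP rP ->]] ->]]]] /=]].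
move=> cP ->; move: iP cP lP rP; rewrite !mem_iota !mem_valid_bforests.
by move=> iP cP /andP[vl /eqP sl] /andP[vr /eqP sr] /=; rewrite vl vr /=; lia.
Qed.

(** Forests with [2 n + 1] nodes; planting one gives a tree with [2 (n + 1)]
    nodes, so [fixed_bforests n] is counted by [a_ n.+1]. *)
Definition fixed_bforests (n : nat) : seq bforest :=
  [seq T <- valid_bforests n.*2.+1 | bh T == T].

Definition indecomposable (T : bforest) : bool :=
  if T is Bsnoc Bnil _ _ then true else false.

Definition indec_fixed_bforests (n : nat) : seq bforest :=
  [seq T <- fixed_bforests n | indecomposable T].

Lemma mem_fixed_bforests n T :
  reflect [/\ bvalid T, bsize T = n.*2.+1 & bh T = T] (T \in fixed_bforests n).
Proof.
rewrite mem_filter mem_valid_bforests.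
by apply: (iffP and3P) => [[/eqP ? ? /eqP ?]|[? -> ->]]; split.
Qed.

Lemma fixed_bforests_uniq n : uniq (fixed_bforests n).
Proof. exact/filter_uniq/valid_bforests_uniq. Qed.

(** The size of [l] counts twice, once in front and once through the grafted [bh l], so a part [l]
    of size [i] leaves [2 (n - i) + 1] nodes. *)
Lemma fixed_bforests_decomposition n :
  perm_eq (fixed_bforests n)
    [seq bcat p.1 (bgraft (bh p.1) p.2)
      | i <- iota 0 n.+1,
        p <- [seq (l, T) | l <- valid_bforests i,
                           T <- indec_fixed_bforests (n - i)]].
Proof.
apply: uniq_perm; first exact: fixed_bforests_uniq.
  apply: uniq_dep_pairs => [|i _|]; first exact: iota_uniq.
    apply: allpairs_uniq => [||[? ?] [? ?]//]; first exact: valid_bforests_uniq.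
    exact/filter_uniq/fixed_bforests_uniq.
  move=> i p j q _ /allpairsP[[l T] /= [lP TP ->]].
  move=> _ /allpairsP[[l' T'] /= [l'P T'P ->]] /=.
  move: lP l'P TP T'P; rewrite !mem_valid_bforests !mem_filter.
  move=> /andP[_ /eqP<-] /andP[_ /eqP<-].
  case: T T' => [|[|? ? ?] c r] [|[|? ? ?] c' r'] //= _ _.
  by case=> <- <- /bgraft_inj <-.
move=> T; apply/mem_fixed_bforests/allpairsPdep.
  case: T => [[]//|l c r] [v szT fT].
  have [r' Er [v' fT']] := fixed_decomposition v fT.
  have vl : bvalid l by case/and3P: v.
  exists (bsize l), (l, Bsnoc Bnil c r'); split; last by rewrite /= Er.
    by rewrite mem_iota; move: szT; rewrite Er /= bsize_graft bsize_h; lia.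
  apply/allpairsP; exists (l, Bsnoc Bnil c r'); split=> //=.
    by rewrite mem_valid_bforests vl eqxx.
  rewrite mem_filter; apply/mem_fixed_bforests; split=> //.
  by move: szT; rewrite Er /= bsize_graft bsize_h; lia.
move=> [i [_ [+ /allpairsP[[l U] /= [+ + ->]] -> /=]]].
rewrite mem_iota mem_valid_bforests mem_filter.
move=> iP /andP[vl /eqP szl] /andP[iU /mem_fixed_bforests[vU szU fU]].
have U0 : U <> Bnil by move=> E; rewrite E in iU.
split; last exact: bcat_graft_fixed.
- by rewrite bvalid_cat vl bvalid_graft ?bvalid_h.
- by rewrite bsize_cat bsize_graft bsize_h szl szU; lia.
Qed.

Lemma indec_fixed_bforests0 : indec_fixed_bforests 0 = [:: Bsnoc Bnil 1 Bnil].
Proof. by []. Qed.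

Lemma indec_fixed_bforestsS n :
  perm_eq (indec_fixed_bforests n.+1)
    [seq Bsnoc Bnil d.+2 (battach d T)
      | T <- fixed_bforests n, d <- iota 0 (broot T)].
Proof.
apply: uniq_perm; first exact/filter_uniq/fixed_bforests_uniq.
  apply: uniq_dep_pairs => [|T _|]; first exact: fixed_bforests_uniq.
    exact: iota_uniq.
  (* [bh] reads both [d] and [U] off [battach d U], which gives the injectivity. *)
  have bh_dT U d : U \in fixed_bforests n -> d \in iota 0 (broot U) ->
      bh (battach d U) = Bsnoc Bnil d.+1 U.
    move=> /mem_fixed_bforests[vU _ fU]; rewrite mem_iota => dU.
    by rewrite bh_attach ?fU // -[in brpath U]fU brpath_h //; lia.
  move=> T d U e TP dP UP eP.
  by case=> de /(congr1 bh); rewrite !bh_dT // => -[-> ->].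
move=> T; rewrite mem_filter; apply/andP/allpairsPdep.
  case: T => [[]//|[|? ? ?] c r] // [_ /mem_fixed_bforests[v szT fT]] //; last first.
  have [E|[d [U [vU fU dU Ec Er]]]] := indecomposable_fixed_inv v fT.
    by rewrite E in szT; move: szT => /=; lia.
  exists U, d; rewrite Ec Er mem_iota; split=> //.
  by apply/mem_fixed_bforests; split=> //; move: szT; rewrite Er /= bsize_attach; lia.
move=> [U [d [/mem_fixed_bforests[vU szU fU] + ->]]]; rewrite mem_iota => dU.
have rpU : brpath U = broot U by rewrite -[in LHS]fU brpath_h.
split=> //; apply/mem_fixed_bforests; split.
- by rewrite /= bvalid_attach ?broot_attach ?rpU //; lia.
- by rewrite /= bsize_attach szU; lia.
- exact: indecomposable_fixed.
Qed.

(** * Series recording size and root label *)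

Local Open Scope ring_scope.

Definition ygf (s : seq bforest) : {poly int} := \sum_(T <- s) 'X^(broot T).

(** Coefficients are kept polynomial in [y] so that [y = 1] can be substituted. In [Fxy] and [Ixy]
    the exponent [n] of [x] stands for size [2 n + 1]. *)
Definition Pxy : {fps {poly int}} := Fps (fun n => ygf (valid_bforests n)).
Definition Fxy : {fps {poly int}} := Fps (fun n => ygf (fixed_bforests n)).
Definition Ixy : {fps {poly int}} := Fps (fun n => ygf (indec_fixed_bforests n)).

Lemma Fxy_decomposition : Fxy = Pxy * Ixy.
Proof.
apply: fpsP => n /=; rewrite {1}/ygf (perm_big _ (fixed_bforests_decomposition n)).
rewrite big_allpairs_dep -[iota 0 n.+1]/(index_iota 0 n.+1) big_mkord /=.
apply: eq_bigr => i _; rewrite big_allpairs_dep /= /ygf big_distrlr /=.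
apply: eq_bigr => l _; rewrite [LHS]big_seq [RHS]big_seq; apply: eq_bigr => T.
rewrite mem_filter => /andP[iT _]; rewrite broot_cat broot_graft ?exprD //.
by move=> E; rewrite E in iT.
Qed.

Lemma geometric_sum (a k : nat) :
  ('X - 1) * \sum_(c <- iota a k) 'X^c = 'X^(a + k) - 'X^a :> {poly int}.
Proof.
elim: k a => [|k IH] a; first by rewrite big_nil addn0 mulr0 subrr.
rewrite /= big_cons mulrDr IH addSnnS exprS; ring.
Qed.

(** * Formal power series *)

Section FpsTheory.
Variable R : comNzRingType.
Implicit Types f g : {fps R}.

Lemma fcoefD f g n : fcoef (f + g) n = fcoef f n + fcoef g n.
Proof. by []. Qed.

Lemma fcoefB f g n : fcoef (f - g) n = fcoef f n - fcoef g n.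
Proof. by []. Qed.

Lemma fcoefM f g n :
  fcoef (f * g) n = \sum_(i < n.+1) fcoef f i * fcoef g (n - i).
Proof. by []. Qed.

Lemma fcoef_fpsC_mul c f n : fcoef (fpsC c * f) n = c * fcoef f n.
Proof.
rewrite fcoefM big_ord_recl /= subn0 big1 ?addr0 // => i _.
by rewrite mul0r.
Qed.

Lemma fcoef_fpsX_mul0 f : fcoef (fpsX * f) 0 = 0.
Proof. by rewrite fcoefM big_ord1 mul0r. Qed.

Lemma fcoef_fpsX_mulS f n : fcoef (fpsX * f) n.+1 = fcoef f n.
Proof.
rewrite fcoefM big_ord_recl mul0r add0r big_ord_recl mul1r subSS subn0.
by rewrite big1 ?addr0 // => i _; rewrite mul0r.
Qed.

(** This is congruence modulo [x ^ n]; [contracting] below is contraction for the [x]-adic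
    metric. *)
Definition agree (n : nat) f g : Prop :=
  forall i, (i < n)%N -> fcoef f i = fcoef g i.

Lemma agree_refl n f : agree n f f.
Proof. by []. Qed.

Lemma agreeD n f g f' g' :
  agree n f g -> agree n f' g' -> agree n (f + f') (g + g').
Proof. by move=> fg fg' i im; rewrite !fcoefD fg ?fg'. Qed.

Lemma agreeB n f g f' g' :
  agree n f g -> agree n f' g' -> agree n (f - f') (g - g').
Proof. by move=> fg fg' i im; rewrite !fcoefB fg ?fg'. Qed.

Lemma agreeM n f g f' g' :
  agree n f g -> agree n f' g' -> agree n (f * f') (g * g').
Proof.
move=> fg fg' i im; rewrite !fcoefM; apply: eq_bigr => j _.
by rewrite fg ?fg' //; have := ltn_ord j; lia.
Qed.

Lemma agreeX n f g : agree n f g -> agree n.+1 (fpsX * f) (fpsX * g).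
Proof.
by move=> fg [|i] im; rewrite ?fcoef_fpsX_mul0 ?fcoef_fpsX_mulS ?fg.
Qed.

Definition contracting (F : {fps R} -> {fps R}) : Prop :=
  forall n f g, agree n f g -> agree n.+1 (F f) (F g).

Lemma contracting_fixpoint F : contracting F -> exists f, f = F f.
Proof.
(* Iterates from the [n]-th on agree below degree [n], so coefficient [n] of the limit is read off
   iterate [n + 1]. *)
move=> cF; pose u n := iter n F 0; pose f := Fps (fun n => fcoef (u n.+1) n).
have uu m n : agree n (u n) (u (n + m)%N).
  by elim: n => [//|n IH]; exact: cF.
have fu n : agree n f (u n).
  by move=> i im; rewrite [LHS](uu (n - i.+1)%N) // addnC subnK.
exists f; apply: fpsP => n; rewrite (fu n.+1) //.
by rewrite (cF n f (u n)).
Qed.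

Lemma fps_inverse_1subX f : exists g, (1 - fpsX * f) * g = 1.
Proof.
have [|g gE] := @contracting_fixpoint (fun g => 1 + fpsX * (f * g)).
  by move=> n g g' gg; apply: agreeD => //; apply: agreeX; apply: agreeM.
by exists g; rewrite mulrBl mul1r -mulrA {1}gE addrK.
Qed.
End FpsTheory.

(** Coefficients are determined one after the other, and [c] has only to be cancelled, not inverted;
    this is applied with [c = y - 1]. *)
Lemma fpsC_mul_unique (R : idomainType) (c : R) (F : {fps R} -> {fps R}) f g :
  c != 0 -> contracting F -> fpsC c * f = F f -> fpsC c * g = F g -> f = g.
Proof.
move=> c0 cF fF gF; suff fg n : agree n f g by apply: fpsP => n; apply: (fg n.+1).
elim: n => [//|n IH] i im; apply: (mulfI c0).
by rewrite -!fcoef_fpsC_mul fF gF (cF _ _ _ IH).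
Qed.

Section FpsMap.
Variables (R S : comNzRingType) (phi : {rmorphism R -> S}).

Definition fps_map (f : {fps R}) : {fps S} := Fps (fun n => phi (fcoef f n)).

Lemma fcoef_map f n : fcoef (fps_map f) n = phi (fcoef f n).
Proof. by []. Qed.

Fact fps_map_is_zmod_morphism : zmod_morphism fps_map.
Proof. by move=> f g; apply: fpsP => n /=; rewrite rmorphB. Qed.

Fact fps_map_is_monoid_morphism : monoid_morphism fps_map.
Proof.
split=> [|f g]; apply: fpsP => n /=.
  by case: (n == 0)%N; rewrite ?rmorph1 ?rmorph0.
by rewrite rmorph_sum; apply: eq_bigr => i _; rewrite rmorphM.
Qed.

HB.instance Definition _ :=
  GRing.isZmodMorphism.Build {fps R} {fps S} fps_map fps_map_is_zmod_morphism.
HB.instance Definition _ :=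
  GRing.isMonoidMorphism.Build {fps R} {fps S} fps_map fps_map_is_monoid_morphism.

Lemma fps_mapX : fps_map fpsX = fpsX.
Proof. by apply: fpsP => n /=; case: (n == 1)%N; rewrite ?rmorph1 ?rmorph0. Qed.

Lemma fps_mapC c : fps_map (fpsC c) = fpsC (phi c).
Proof. by apply: fpsP => n /=; case: (n == 0)%N; rewrite ?rmorph0. Qed.

Lemma agree_map n f g : agree n f g -> agree n (fps_map f) (fps_map g).
Proof. by move=> fg i im /=; rewrite fg. Qed.
End FpsMap.

Section PolyToFps.
Variable R : comNzRingType.

Definition poly_fps (p : {poly R}) : {fps R} := Fps (fun k => p`_k).

Fact poly_fps_is_zmod_morphism : zmod_morphism poly_fps.
Proof. by move=> p q; apply: fpsP => k /=; rewrite coefB. Qed.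

Fact poly_fps_is_monoid_morphism : monoid_morphism poly_fps.
Proof.
split=> [|p q]; apply: fpsP => k /=; last by rewrite coefM.
by rewrite coef1; case: k.
Qed.

HB.instance Definition _ :=
  GRing.isZmodMorphism.Build {poly R} {fps R} poly_fps poly_fps_is_zmod_morphism.
HB.instance Definition _ :=
  GRing.isMonoidMorphism.Build {poly R} {fps R} poly_fps
    poly_fps_is_monoid_morphism.

Lemma poly_fpsX : poly_fps 'X = fpsX.
Proof. by apply: fpsP => k /=; rewrite coefX; case: (k == 1)%N. Qed.

Lemma poly_fpsC c : poly_fps c%:P = fpsC c.
Proof. by apply: fpsP => k /=; rewrite coefC. Qed.
End PolyToFps.

(** * Algebraic identities satisfied by the explicit solutions *)

Section Algebra.
Variables (R : comNzRingType) (t s y U : R).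
Let z : R := t * (1 - t) * y.
Let x : R := t * (1 - t) ^+ 2.
Let Q : R := 1 + (z - t) * U.
Let D : R := 1 - t - z - z ^+ 2 * U.
Hypothesis hs : (1 - t) * s = 1.
Hypothesis hU : U = 1 + z * U + t * z * U ^+ 2.

Let mulI a b : (1 - t) * a = (1 - t) * b -> a = b.
Proof.
move=> /(congr1 ( *%R s)); rewrite !mulrA ![s * _]mulrC hs.
by rewrite !mul1r.
Qed.

Let hP : (1 - t) * (s * Q) = Q.
Proof. by rewrite mulrA hs mul1r. Qed.

(** The term [s * (1 - t ^+ 2 * s)] is the value of [s * Q] at [y = 1], where [U] becomes [s]. *)
Lemma forest_series_equation :
  (y - 1) * (s * Q) = (y - 1) +
    x * ((s * Q) * (y * (s * Q - s * (1 - t ^+ 2 * s)) + y * (y - 1))).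
Proof.
have hp : (1 - t) ^+ 2 * (s * (1 - t ^+ 2 * s)) = 1 - t - t ^+ 2.
  transitivity ((1 - t) * s * (1 - t - t ^+ 2 * ((1 - t) * s))); first by ring.
  by rewrite hs; ring.
have hP' := hP; set P := s * Q in hP' *.
set p := s * (1 - _) in hp *; apply: mulI.
transitivity ((y - 1) * ((1 - t) * P)); first by ring.
(* Powers of [1 - t] are distributed so that [P] and [p] occur only in [(1 - t) * P] and
   [(1 - t) ^+ 2 * p], which are free of [s]. *)
transitivity ((y - 1) * (1 - t) + t * (1 - t) * y * ((1 - t) * P) ^+ 2
  - t * y * ((1 - t) * P) * ((1 - t) ^+ 2 * p)
  + t * (1 - t) ^+ 2 * y * (y - 1) * ((1 - t) * P)); last by rewrite /x; ring.
rewrite hP' hp; apply: subr0_eq.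
(* Both sides have degree 2 in [U], so the cofactor of the equation of [U] is the
   value of their difference at [U = 0]. *)
transitivity ((t * (y - 1) - t ^+ 3 * y - t * (1 - t) ^+ 2 * y * (y - 1))
  * (1 + z * U + t * z * U ^+ 2 - U)); first by rewrite /Q /z; ring.
by rewrite -hU subrr mulr0.
Qed.

Variable v : R.
Hypothesis hv : D * v = 1.

Let mulDI a b : D * a = D * b -> a = b.
Proof.
move=> /(congr1 ( *%R v)); rewrite !mulrA ![v * _]mulrC hv.
by rewrite !mul1r.
Qed.

Let hF : D * (v * (y * Q)) = y * Q.
Proof. by rewrite mulrA hv mul1r. Qed.

(** Here [s ^+ 2] is the value of the fixed-point series at [y = 1]. Multiplying by [D] and [1 - t]
    leaves a polynomial identity. *)
Lemma fixed_series_equation :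
  (y - 1) * (v * (y * Q)) =
  (s * Q) * (y * (y - 1) + x * (y ^+ 2 * (v * (y * Q) - s ^+ 2))).
Proof.
have hx : x * s ^+ 2 = t.
  transitivity (t * ((1 - t) * s) ^+ 2); first by rewrite /x; ring.
  by rewrite hs; ring.
have [hP' hF'] := (hP, hF); set F := v * (y * Q) in hF' *.
set P := s * Q in hP' *; apply: mulDI; apply: mulI.
transitivity ((1 - t) * (y - 1) * (D * F)); first by ring.
transitivity (((1 - t) * P) * (y * (y - 1) * D + x * y ^+ 2 * (D * F)
    - (x * s ^+ 2) * y ^+ 2 * D)); last by ring.
by rewrite hF' hP' hx /x /D /Q /z; ring.
Qed.

Lemma fixed_series_quadratic : let A := x * (v * (y * Q)) in
  (2 * y * t - 1) * A ^+ 2 - (3 * y * t ^+ 2 - 3 * y * t + 1) * A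
    + y * t ^+ 3 - 2 * y * t ^+ 2 + y * t = 0.
Proof.
move=> A; have hA : D * A = x * y * Q.
  transitivity (x * (D * (v * (y * Q)))); first by rewrite /A; ring.
  by rewrite hF; ring.
apply: mulDI; apply: mulDI; rewrite !mulr0.
transitivity ((2 * y * t - 1) * (D * A) ^+ 2
  - (3 * y * t ^+ 2 - 3 * y * t + 1) * (D * A) * D
  + y * t * (1 - t) ^+ 2 * D ^+ 2); first by ring.
(* After clearing [D ^+ 2] the expression has degree 2 in [U], so the cofactor of the equation of
   [U] is again its value at [U = 0]. *)
rewrite hA; transitivity (
  ((2 * y * t - 1) * (z * (1 - t)) ^+ 2
   - (1 - 3 * z) * (z * (1 - t)) * (1 - t - z)
   + y * t * (1 - t) ^+ 2 * (1 - t - z) ^+ 2)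
  * (1 + z * U + t * z * U ^+ 2 - U)); first by rewrite /x /D /Q /z; ring.
by rewrite -hU subrr mulr0.
Qed.
End Algebra.

Lemma rmorph_quadratic (R S : comNzRingType) (phi : {rmorphism R -> S})
    (y t A : R) :
  (2 * y * t - 1) * A ^+ 2 - (3 * y * t ^+ 2 - 3 * y * t + 1) * A
    + y * t ^+ 3 - 2 * y * t ^+ 2 + y * t = 0 ->
  (2 * phi y * phi t - 1) * phi A ^+ 2
    - (3 * phi y * phi t ^+ 2 - 3 * phi y * phi t + 1) * phi A
    + phi y * phi t ^+ 3 - 2 * phi y * phi t ^+ 2 + phi y * phi t = 0.
Proof. by move=> /(congr1 phi); rewrite rmorph0 => <-; ring. Qed.

(** * Coefficients of the ternary tree series *)

(** This is the Lagrange inversion formula for powers of [s], with denominators cleared. It follows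
    by induction on [n], then [r], from [s ^+ r.+1 = s ^+ r + x * s ^+ (r + 3)]. *)
Lemma ternary_power_coef (s : {fps int}) : s = 1 + fpsX * s ^+ 3 ->
  forall n r, (3 * n + r)%:R * fcoef (s ^+ r) n = (r * 'C(3 * n + r, n))%:R.
Proof.
move=> hs; have s0 r : fcoef (s ^+ r) 0 = 1.
  elim: r => [//|r IH]; rewrite exprS fcoefM big_ord1 IH mulr1 hs fcoefD.
  by rewrite fcoef_fpsX_mul0 addr0.
have sS n r : fcoef (s ^+ r.+1) n.+1 = fcoef (s ^+ r) n.+1 + fcoef (s ^+ (r + 3)) n.
  rewrite exprS {1}hs mulrDl mul1r -mulrA -exprD addnC fcoefD.
  by rewrite fcoef_fpsX_mulS.
elim=> [|n IHn] r; first by rewrite s0 bin0 mulr1 muln1.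
elim: r => [|r IHr]; first by rewrite mul0n mulr0.
set M := (3 * n.+1 + r)%N in IHr *; rewrite addnS -/M.
have M0 : M%:R != 0 :> int by rewrite pnatr_eq0 /M; lia.
apply: (mulfI M0).
have {}IHn := IHn (r + 3)%N.
have EM : (3 * n + (r + 3))%N = M by rewrite /M; lia.
rewrite EM in IHn.
transitivity (M.+1%:R * (M%:R * fcoef (s ^+ r) n.+1 + M%:R * fcoef (s ^+ (r + 3)) n)).
  by rewrite sS; ring.
rewrite IHr IHn -!natrD -!natrM; congr _%:R.
have := mul_bin_left M n; rewrite binS.
have -> : (M - n = 2 * n + 3 + r)%N by rewrite /M; lia.
by move: EM; move: ('C(M, n)) ('C(M, n.+1)) => a b; nia.
Qed.

(** * Generating functions *)

Definition at1 : {fps {poly int}} -> {fps int} := fps_map (horner_eval (1 : int)).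
Definition cst : {fps int} -> {fps {poly int}} := fps_map (@polyC int).

HB.instance Definition _ := GRing.RMorphism.on at1.
HB.instance Definition _ := GRing.RMorphism.on cst.

Local Notation Y := (fpsC ('X : {poly int})).

Lemma at1_cst f : at1 (cst f) = f.
Proof. by apply: fpsP => n /=; rewrite /horner_eval hornerC. Qed.

Lemma at1Y : at1 Y = 1.
Proof. by rewrite /at1 fps_mapC /= /horner_eval hornerX. Qed.

Lemma at1X : at1 fpsX = fpsX. Proof. exact: fps_mapX. Qed.

Lemma cstX : cst fpsX = fpsX. Proof. exact: fps_mapX. Qed.

Lemma ygf_at1 s : (ygf s).[1] = (size s)%:R.
Proof.
rewrite /ygf horner_sum -sum1_size natr_sum; apply: eq_bigr => T _.
by rewrite hornerXn expr1n.
Qed.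

Lemma fcoef_cst_at1 f n : fcoef (cst (at1 f)) n = (fcoef f n).[1]%:P.
Proof. by []. Qed.

Lemma fpsC_Xsub1 : fpsC ('X - 1) = Y - 1 :> {fps {poly int}}.
Proof. by apply: fpsP => -[|n] /=; rewrite ?subr0. Qed.

Lemma Pxy_equation :
  fpsC ('X - 1) * Pxy = (Y - 1) +
    fpsX * (Pxy * (Y * (Pxy - cst (at1 Pxy)) + Y * (Y - 1))).
Proof.
(* [L] is the series of the possible last trees, by size of the subforest and root label. *)
pose L : {fps {poly int}} := Fps (fun n => \sum_(r <- valid_bforests n)
  \sum_(c <- iota 1 (maxn 1 (broot r))) 'X^c).
have PE : Pxy = 1 + fpsX * (Pxy * L).
  apply: fpsP => -[|n].
    rewrite fcoefD fcoef_fpsX_mul0 addr0 /= valid_bforests0 /ygf big_seq1.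
    by rewrite expr0.
  rewrite fcoefD fcoef_fpsX_mulS add0r [LHS]/=.
  rewrite /ygf (perm_big _ (valid_bforestsS n)) big_allpairs_dep big_allpairs_dep.
  rewrite -[iota 0 n.+1]/(index_iota 0 n.+1) big_mkord /=.
  apply: eq_bigr => i _; rewrite big_allpairs_dep /= big_distrlr /=.
  apply: eq_bigr => l _; apply: eq_bigr => r _; rewrite mulr_sumr.
  by apply: eq_bigr => c _; rewrite exprD.
have LE : (Y - 1) * L = Y * (Pxy - cst (at1 Pxy)) + Y * (Y - 1).
  apply: fpsP => n; rewrite -fpsC_Xsub1 fcoefD !fcoef_fpsC_mul fcoefB.
  rewrite fcoef_cst_at1 [fcoef Pxy n]/= ygf_at1 [fcoef L n]/= mulr_sumr.
  under eq_bigr do rewrite geometric_sum.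
  (* The empty subforest has root sum 0 but still allows label 1; this gives the correction
     [Y * (Y - 1)]. *)
  case: n => [|n].
    by rewrite valid_bforests0 /ygf !big_seq1 /= expr0 expr2; ring.
  rewrite mulr0 addr0 /ygf -sum1_size natr_sum rmorph_sum -sumrB mulr_sumr.
  rewrite [LHS]big_seq [RHS]big_seq; apply: eq_bigr => T.
  rewrite mem_valid_bforests => /andP[vT szT].
  have T0 : (0 < broot T)%N by apply: broot_gt0 => // E; rewrite E in szT.
  have -> : maxn 1 (broot T) = broot T by lia.
  by rewrite rmorph1 add1n exprS expr1 mulrBr mulr1.
rewrite fpsC_Xsub1 -LE {1}PE; ring.
Qed.

(** The single edge gives [Y * (Y - 1)]; a fixed point of root [m] yields the labels [2] to [m + 1],
    summed as a geometric progression. *)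
Lemma Ixy_equation :
  (Y - 1) * Ixy = Y * (Y - 1) + fpsX * (Y ^+ 2 * (Fxy - cst (at1 Fxy))).
Proof.
apply: fpsP => n; rewrite -fpsC_Xsub1 fcoefD !fcoef_fpsC_mul.
case: n => [|n].
  rewrite fcoef_fpsX_mul0 addr0 [fcoef Ixy 0]/= indec_fixed_bforests0 /ygf.
  by rewrite big_seq1 /= expr1 mulrC.
rewrite fcoef_fpsX_mulS expr2 -mulrA !fcoef_fpsC_mul fcoefB fcoef_cst_at1.
rewrite [fcoef Fxy n]/= ygf_at1 [fcoef Ixy _]/= /ygf mulr0 add0r.
rewrite (perm_big _ (indec_fixed_bforestsS n)) big_allpairs_dep /=.
rewrite -sum1_size natr_sum rmorph_sum -sumrB !mulr_sumr.
rewrite [LHS]big_seq [RHS]big_seq; apply: eq_bigr => T _.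
transitivity ('X * ('X * (('X - 1) * \sum_(d <- iota 0 (broot T)) 'X^d)) : {poly int}).
  rewrite !mulr_sumr; apply: eq_bigr => d _; rewrite add0n !exprS; ring.
by rewrite geometric_sum add0n expr0 rmorph1.
Qed.

Lemma Fxy_equation :
  fpsC ('X - 1) * Fxy =
  Pxy * (Y * (Y - 1) + fpsX * (Y ^+ 2 * (Fxy - cst (at1 Fxy)))).
Proof. by rewrite -Ixy_equation {1}Fxy_decomposition fpsC_Xsub1; ring. Qed.

(** * The counted trees in terms of the enumerations *)

Lemma card_fset_set_map (T U : choiceType) (f : T -> U) (A : set U) (s : seq T) :
  injective f -> uniq s -> (forall u, A u <-> exists2 x, x \in s & u = f x) ->
  #|` fset_set A| = size s.
Proof.
move=> f_inj s_uniq AE; have -> : fset_set A = [fset u in map f s]%fset.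
  rewrite -[RHS]set_fsetK; congr fset_set; apply/seteqP; split=> u /=.
    by move=> /AE[x xs ->]; rewrite inE map_f.
  by rewrite inE => /mapP[x xs ->]; apply/AE; exists x.
by rewrite card_fseq undup_id ?size_map // map_inj_uniq.
Qed.

Lemma a_fixed_bforests n : a_ n.+1 = size (fixed_bforests n).
Proof.
apply: card_fset_set_map plant_forest_of_inj (fixed_bforests_uniq n) _ => X.
split=> [/fixed_trees_forest_of[T [vT sT fT ->]]|[T /mem_fixed_bforests[vT sT fT] ->]].
  by exists T => //; apply/mem_fixed_bforests.
by apply/fixed_trees_forest_of; exists T.
Qed.

Lemma a_root_fixed_bforests n k :
  a_root n.+1 k = count (fun T => broot T == k) (fixed_bforests n).
Proof.
rewrite -size_filter; apply: card_fset_set_map plant_forest_of_inj _ _.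
  exact/filter_uniq/fixed_bforests_uniq.
move=> X; split.
  move=> [/fixed_trees_forest_of[T [vT sT fT ->]]].
  rewrite /= sum_labels_forest_of => Tk; exists T => //.
  by rewrite mem_filter Tk eqxx; apply/mem_fixed_bforests.
move=> [T]; rewrite mem_filter => /andP[/eqP Tk /mem_fixed_bforests[vT sT fT]] ->.
by split; [apply/fixed_trees_forest_of; exists T | rewrite /= sum_labels_forest_of].
Qed.

Lemma AxE : Ax = at1 (fpsX * Fxy).
Proof.
apply: fpsP => -[|n]; rewrite /at1 fcoef_map.
  by rewrite fcoef_fpsX_mul0 rmorph0.
by rewrite fcoef_fpsX_mulS /= /horner_eval ygf_at1 a_fixed_bforests.
Qed.

Lemma AxyE : Axy = fps_map (@poly_fps int) (fpsX * Fxy).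
Proof.
apply: fpsP => -[|n]; apply: fpsP => k; rewrite fcoef_map.
  by rewrite fcoef_fpsX_mul0 rmorph0.
rewrite fcoef_fpsX_mulS /= a_root_fixed_bforests /ygf coef_sum -sum1_count.
rewrite natr_sum big_mkcond /=; apply: eq_bigr => T _; rewrite coefXn eq_sym.
by case: eqP.
Qed.

(** * Solution of the functional equations *)

Lemma Fxy_solution : exists s : {fps int}, s = 1 + fpsX * s ^+ 3 /\
  exists U v, let t := cst (fpsX * s ^+ 2) in let z := t * (1 - t) * Y in
   [/\ (1 - t) * cst s = 1, fpsX = t * (1 - t) ^+ 2,
       U = 1 + z * U + t * z * U ^+ 2,
       (1 - t - z - z ^+ 2 * U) * v = 1
     & at1 Fxy = s ^+ 2 /\ Fxy = v * (Y * (1 + (z - t) * U))].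
Proof.
have [|s sE] := @contracting_fixpoint int (fun s => 1 + fpsX * s ^+ 3).
  move=> n f g fg; apply: agreeD => //; apply: agreeX.
  by rewrite !exprS !expr0; do !apply: agreeM.
exists s; split=> //.
have [t1 t1E] : exists t1, t1 = fpsX * s ^+ 2 by exists (fpsX * s ^+ 2).
have hs1 : (1 - t1) * s = 1.
  by rewrite t1E mulrBl mul1r -mulrA -exprSr {1}sE addrK.
have [S SE] : exists S, S = cst s by exists (cst s).
have [t tE] : exists t, t = cst t1 by exists (cst t1).
have S1 : at1 S = s by rewrite SE at1_cst.
have tt1 : at1 t = t1 by rewrite tE at1_cst.
have hs : (1 - t) * S = 1.
  by rewrite tE SE -(rmorph1 cst) -rmorphB -rmorphM hs1.
have tX : t = fpsX * S ^+ 2 by rewrite tE SE t1E rmorphM rmorphXn /= cstX.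
have xE : fpsX = t * (1 - t) ^+ 2.
  transitivity (fpsX * ((1 - t) * S) ^+ 2); first by rewrite hs expr1n mulr1.
  by rewrite {2}tX; ring.
rewrite -t1E -tE -SE; have [z zE] : exists z, z = t * (1 - t) * Y by eexists.
(* Both [z] and [t] are multiples of [x], which makes the equation of [U] contracting and [D]
   invertible. *)
have zX : z = fpsX * (S ^+ 2 * (1 - t) * Y) by rewrite zE {1}tX; ring.
have [|U UE] := @contracting_fixpoint _ (fun U => 1 + z * U + t * z * U ^+ 2).
  move=> n f g fg; apply: agreeD; first apply: agreeD => //.
    by rewrite zX -!mulrA; apply: agreeX; do !apply: agreeM.
  by rewrite tX !expr2 -!mulrA; apply: agreeX; do !apply: agreeM.
have [v vE] : exists v, (1 - t - z - z ^+ 2 * U) * v = 1.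
  have [v vE] := fps_inverse_1subX (S ^+ 2 + S ^+ 2 * (1 - t) * Y
    + (S ^+ 2 * (1 - t) * Y) * (z * U)).
  exists v; rewrite -[RHS]vE; congr (_ * v).
  transitivity (1 - fpsX * S ^+ 2 - fpsX * (S ^+ 2 * (1 - t) * Y)
    - fpsX * (S ^+ 2 * (1 - t) * Y) * (z * U)); last by ring.
  by rewrite -zX -tX; ring.
exists U, v; rewrite /= -zE; split=> //.
have z1 : at1 z = t1 * (1 - t1).
  by rewrite zE !rmorphM rmorphB rmorph1 /= at1Y tt1 mulr1.
(* At [y = 1], both [u] and [s] solve the equation of [U]; the difference factors as [u - s] times a
   series with constant term 1, hence invertible. *)
have U1 : at1 U = s.
  have := congr1 at1 UE; rewrite !(rmorphXn, rmorphD, rmorphM, rmorph1) /= z1 tt1.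
  set u := at1 U => uE.
  have [w wE] := fps_inverse_1subX (s ^+ 2 * (1 - t1) * (1 + t1 * (u + s))).
  apply: subr0_eq; rewrite -[LHS]mulr1 -[X in _ * X = _]wE (mulrA (u - s)).
  have -> : (u - s) * (1 - fpsX * (s ^+ 2 * (1 - t1) * (1 + t1 * (u + s)))) = 0.
    transitivity ((u - s) *
      (1 - (fpsX * s ^+ 2) * ((1 - t1) * (1 + t1 * (u + s))))); first by ring.
    rewrite -t1E; transitivity (u - t1 * (1 - t1) * u
      - t1 * (t1 * (1 - t1)) * u ^+ 2 - s + t1 * ((1 - t1) * s) * (1 + t1 * s)).
      by ring.
    rewrite {1}uE hs1; transitivity ((1 + t1) * (1 - (1 - t1) * s)); first by ring.
    by rewrite hs1 subrr mulr0.
  by rewrite mul0r.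
have PE : Pxy = S * (1 + (z - t) * U).
  pose G (f : {fps {poly int}}) : {fps {poly int}} :=
    (Y - 1) + fpsX * (f * (Y * (f - cst (at1 f)) + Y * (Y - 1))).
  apply: (@fpsC_mul_unique _ ('X - 1) G) Pxy_equation _ => [|n f g fg|].
  - by rewrite polyXsubC_eq0.
  - rewrite /G; apply: agreeD; [exact: agree_refl | apply: agreeX].
    apply: agreeM; [exact: fg | apply: agreeD; last exact: agree_refl].
    apply: agreeM; [exact: agree_refl | apply: agreeB; first exact: fg].
    by do 2!apply: agree_map.
  - rewrite /G fpsC_Xsub1 xE zE.
    (* The equation involves the unknown at [y = 1], so this value of the candidate is computed
       first. *)
    have -> : cst (at1 (S * (1 + (t * (1 - t) * Y - t) * U))) =
        S * (1 - t ^+ 2 * S).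
      rewrite -zE !(rmorphM, rmorphB, rmorphD, rmorph1) /= z1 tt1 U1 S1.
      rewrite !(rmorphM, rmorphB, rmorphD, rmorph1) /= -tE -SE; ring.
    by apply: forest_series_equation; rewrite -?zE.
have F1 : at1 (v * (Y * (1 + (z - t) * U))) = s ^+ 2.
  have := congr1 at1 vE.
  rewrite !(rmorphXn, rmorphM, rmorphB, rmorphD, rmorph1) /= z1 tt1 U1 at1Y.
  set w := at1 v => wE.
  (* At [y = 1] the numerator equals [s ^+ 2] times the denominator inverted by [w]. *)
  have Q1 : 1 + (t1 * (1 - t1) - t1) * s =
      (1 - t1 - t1 * (1 - t1) - (t1 * (1 - t1)) ^+ 2 * s) * s ^+ 2.
    transitivity ((1 - t1) * s - t1 ^+ 2 * s); first by rewrite hs1; ring.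
    transitivity (((1 - t1) * s) * s - t1 * ((1 - t1) * s) * s
       - t1 ^+ 2 * ((1 - t1) * s) ^+ 2 * s); last by ring.
    by rewrite hs1 -[X in X - _ = _]hs1; ring.
  by rewrite mul1r Q1 mulrA [w * _]mulrC wE mul1r.
suff FE : Fxy = v * (Y * (1 + (z - t) * U)) by rewrite {1}FE F1.
pose G (f : {fps {poly int}}) : {fps {poly int}} :=
  Pxy * (Y * (Y - 1) + fpsX * (Y ^+ 2 * (f - cst (at1 f)))).
apply: (@fpsC_mul_unique _ ('X - 1) G) Fxy_equation _ => [|n f g fg|].
- by rewrite polyXsubC_eq0.
- rewrite /G; apply: agreeM; [exact: agree_refl | apply: agreeD].
    exact: agree_refl.
  apply: agreeX; apply: agreeM; [exact: agree_refl | apply: agreeB].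
    exact: fg.
  by do 2!apply: agree_map.
- rewrite /G F1 fpsC_Xsub1 PE xE rmorphXn /= -SE zE.
  by apply: fixed_series_equation; rewrite -?zE.
Qed.

(** * The equation for [Ax] and the closed formula *)

Lemma fixed_trees_series : exists s : {fps int},
  [/\ s = 1 + fpsX * s ^+ 3, Ax = fpsX * s ^+ 2 & (1 - Ax) * s = 1].
Proof.
have [s [sE [U [v /= [_ _ _ _ [F1 _]]]]]] := Fxy_solution.
have AE : Ax = fpsX * s ^+ 2 by rewrite AxE rmorphM /= at1X F1.
exists s; split=> //.
by rewrite AE mulrBl mul1r -mulrA -exprSr {1}sE addrK.
Qed.

(** The coefficient formula at [r = 2] gives [(3 n + 2) a = 2 C(3 n + 2, n)] for [a = a_ n.+1]; then
    [(3 n + 2) C(3 n + 1, n) = 2 (n + 1) C(3 n + 2, n)] lowers the upper index. *)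
Lemma a_closed_form n :
  (a_ n.+1)%:R = 1 / n.+1%:R * 'C(3 * n + 1, n)%:R :> rat.
Proof.
have [s [sE AE _]] := fixed_trees_series.
have := ternary_power_coef sE n 2.
have -> : fcoef (s ^+ 2) n = (a_ n.+1)%:R.
  by rewrite -fcoef_fpsX_mulS -AE.
rewrite -natrM => /eqP; rewrite eqr_nat => /eqP aE.
have n1 : n.+1%:R != 0 :> rat by rewrite pnatr_eq0.
rewrite mul1r mulrC; apply: (canRL (mulfK n1)); rewrite -natrM; congr _%:R.
have := mul_bin_down (3 * n + 2) n; rewrite addnS /=.
have -> : ((3 * n + 1).+1 - n = n.+1 * 2)%N by lia.
rewrite -addnS => bE; apply/eqP.
have M0 : (0 < 3 * n + 2)%N by rewrite addnS.
by rewrite -(eqn_pmul2l M0) mulnA aE bE -[X in _ == X]mulnA [X in _ == X]mulnC.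
Qed.

Theorem theorem4 :
  [/\ Ax * (1 - Ax) ^+ 2 = fpsX,
      forall n : nat, (1 <= n)%N ->
        (a_ n)%:R = 1 / n%:R * 'C(3 * n - 2, n - 1)%:R :> rat
    & let y : {fps2 int} := fps2Y in
      let A : {fps2 int} := in_x Ax in
      (2 * y * A - 1) * Axy ^+ 2
        - (3 * y * A ^+ 2 - 3 * y * A + 1) * Axy
        + y * A ^+ 3 - 2 * y * A ^+ 2 + y * A = 0 ].
Proof.
split.
- have [s [_ AE As]] := fixed_trees_series.
  transitivity (fpsX * ((1 - Ax) * s) ^+ 2); last by rewrite As expr1n mulr1.
  by rewrite {1}AE; ring.
- case=> // n _; rewrite a_closed_form; congr (_ * 'C(_, _)%:R); lia.
- move=> y A; have [s [sE [U [v /= [hs xE UE vE [F1 FE]]]]]] := Fxy_solution.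
  have := fixed_series_quadratic UE vE.
  have AE : fpsX * s ^+ 2 = Ax by rewrite AxE rmorphM /= at1X F1.
  rewrite /= -xE -FE AE => quad.
  (* The quadratic holds over polynomials in [y]; embedding these into power series in [y]
     transports it to [Axy]. *)
  have -> : A = fps_map (@poly_fps int) (cst Ax).
    by apply: fpsP => n; rewrite fcoef_map /= poly_fpsC.
  have -> : y = fps_map (@poly_fps int) Y by rewrite fps_mapC /= poly_fpsX.
  by rewrite AxyE; apply: (rmorph_quadratic (fps_map (@poly_fps int))) quad.
Qed.
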